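(* Let $A$ be an integral domain and $E$ an $A$-module. Let $S=\{a\in A: aE\text{ is a maximal element, with respect to inclusion, of the set }\{bE\}_{b\in W(E)^{\#}}\}$. Then every open dense set in $qD_A(E)$ contains $\operatorname{EC}(S)=\{[a]: a\in S\}$.
   Context: For an $A$-module $E$: $\operatorname{ann}(E)=\{a\in A: aE=0\}$, $W(E)=\{a\in A: aE\neq E\}$, $W(E)^{\#}=W(E)\setminus\operatorname{ann}(E)$. On $W(E)^{\#}$ put $a\sim b$ iff $aE=bE$; $[a]$ is the class of $a$ and $\operatorname{EC}(W(E)^{\#})$ is the set of all classes. For $a\in W(E)^{\#}$, $U_a=\{[b]\in\operatorname{EC}(W(E)^{\#}): aE\subseteq bE\}$. The quasi divisor topology $qD_A(E)$ is the topological space $\operatorname{EC}(W(E)^{\#})$ whose topology has basis $\{U_a\}_{a\in W(E)^{\#}}$. (A maximal element of the set is in particular a member of it, so $S\subseteq W(E)^{\#}$.) *)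

(* Defs.v *)
From HB Require Import structures.
From mathcomp Require Import all_boot all_algebra all_classical.
From mathcomp Require Import topology.

Set Implicit Arguments.
Unset Strict Implicit.
Unset Printing Implicit Defensive.

Import GRing.Theory.
Local Open Scope classical_set_scope.
Local Open Scope ring_scope.
Local Open Scope quotient_scope.

Section QuasiDivisorTopology.
Variables (A : idomainType) (E : lmodType A).

Definition mul_image (a : A) : set E := range (fun x : E => a *: x).

Definition ann : set A := [set a | mul_image a = [set 0]].

Definition W : set A := [set a | mul_image a <> setT].

Definition Wsharp : set A := W `\` ann.

Definition sim (a b : Wsharp) : bool := `[< mul_image (val a) = mul_image (val b) >].

Lemma sim_equiv : equiv_class_of sim.
Proof.
split=> [a|a b|b a c]; rewrite /sim; first exact/asboolP.
- by apply/asboolP/asboolP.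
- by move=> /asboolP ab /asboolP bc; apply/asboolP; rewrite ab.
Qed.

Canonical sim_equiv_rel := EquivRelPack sim_equiv.

Definition qD : Type := {eq_quot sim_equiv_rel}.

HB.instance Definition _ := Choice.on qD.
HB.instance Definition _ := EqQuotient.on qD.

Definition cls (a : Wsharp) : qD := \pi_qD a.

Lemma cls_eqP (a b : Wsharp) :
  cls a = cls b <-> mul_image (val a) = mul_image (val b).
Proof.
split; first by move=> /eqmodP /asboolP.
by move=> ab; apply/eqmodP/asboolP.
Qed.

Definition U (a : Wsharp) : set qD :=
  [set cls b | b in [set b : Wsharp | mul_image (val a) `<=` mul_image (val b)]].

Lemma U_cover : \bigcup_(V in range U) V = setT.
Proof.
rewrite -subTset => c _; exists (U (repr c)); first by exists (repr c).
by exists (repr c) => //; rewrite /cls reprK.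
Qed.

Lemma U_join (V V' : set qD) c : range U V -> range U V' -> V c -> V' c ->
  exists V'', [/\ range U V'', V'' c & V'' `<=` V `&` V'].
Proof.
move=> [a _ <-] [a' _ <-] [b /= ab <-] [b' /= ab' /cls_eqP bb'].
exists (U b); split; first by exists b.
  by exists b.
move=> _ [d /= bd <-]; split; exists d => //=; first exact: subset_trans bd.
by rewrite bb' in ab'; exact: subset_trans bd.
Qed.

HB.instance Definition _ := isBaseTopological.Build qD U_cover U_join.

Lemma qD_basis : basis (range U).
Proof.
have oU a : open (U a).
  exists [set U a]; last by rewrite bigcup_set1.
  by move=> _ ->; exists a.
split; first by move=> _ [a _ <-].
move=> c V; rewrite nbhsE => -[O [[D DU OE] Oc] OV].
move: Oc; rewrite -OE => -[B DB Bc].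
exists B; first by split=> //; exact: DU.
by apply: subset_trans OV; rewrite -OE => x Bx; exists B.
Qed.

Definition maximal_member (F : set (set E)) (M : set E) : Prop :=
  F M /\ forall N, F N -> M `<=` N -> N = M.

Definition S : set A :=
  [set a | maximal_member [set mul_image b | b in Wsharp] (mul_image a)].

Lemma S_sub_Wsharp : S `<=` Wsharp.
Proof.
by move=> a [[b [Wb annb] ba] _]; split; rewrite /W /ann /= -ba.
Qed.

(* Classes exist only for elements of [Wsharp]; for [X] included in [Wsharp]
   this is the set of all classes of elements of [X]. *)
Definition EC (X : set A) : set qD := [set cls a | a in [set a : Wsharp | X (val a)]].

End QuasiDivisorTopology.

(* Main.v *)
Require Import Defs.
From mathcomp Require Import all_boot all_algebra all_classical topology.
Local Open Scope classical_set_scope.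

(** A class [cls a] with [mul_image a] maximal is an isolated point: [U a]
    collects the classes of those [b] whose image contains that of [a], and
    maximality leaves only [cls a] itself. A dense set meets every nonempty
    open set, so it contains every isolated point. *)

Lemma U_maximal (A : idomainType) (E : lmodType A) (a : Wsharp E) :
  S E (val a) -> U a = [set cls a].
Proof.
move=> [_ amax]; rewrite eqEsubset; split=> [_ [b /= ab <-]|_ ->].
  apply/cls_eqP; apply: amax ab.
  by exists (val b) => //; exact: set_valP.
by exists a.
Qed.

Lemma dense_isolated (T : topologicalType) (D : set T) (x : T) :
  dense D -> open [set x] -> D x.
Proof.
move=> dD ox; have [||_ [-> //]] := dD [set x].
- by exists x.
- exact: ox.
Qed.

Theorem proposition5 (A : idomainType) (E : lmodType A) (O : set (qD E)) :
  open O -> dense O -> EC (S E) `<=` O.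
Proof.
move=> _ dO _ [a Sa <-]; apply: dense_isolated dO _.
rewrite -(U_maximal _ _ _ Sa).
by have [oU _] := @qD_basis A E; apply: oU; exists a.
Qed.
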